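(* Let $\mathcal{J}$ be a maximal ideal on $\mathbb{N}$ and define $\delta:\mathcal{P}(\mathbb{N})\to[0,1]$ by $\delta(A)=\lim^{\mathcal{J}}\frac{|A\cap\{1,\dots,n\}|}{n}$. Then $\mathcal{Z}_\delta\neq t(\mathcal{I})$ for every maximal ideal $\mathcal{I}$ on $\mathbb{N}$.
   Context: For $A\subseteq\mathbb{N}$ and $k\in\mathbb{Z}$, $A+k$ denotes $\{a+k:a\in A\}\cap\mathbb{N}$. An ideal on $\mathbb{N}$ is a family $\mathcal{I}\subseteq\mathcal{P}(\mathbb{N})$ closed under finite unions and subsets, containing all finite subsets of $\mathbb{N}$, with $\mathbb{N}\notin\mathcal{I}$; it is maximal if it is not properly contained in another ideal on $\mathbb{N}$. For an ideal $\mathcal{J}$, a real sequence $(x_n)$ is $\mathcal{J}$-convergent to $L$, written $L=\lim^{\mathcal{J}}x_n$, if $\{n\in\mathbb{N}:|x_n-L|\ge\varepsilon\}\in\mathcal{J}$ for every $\varepsilon>0$ (for maximal $\mathcal{J}$ every bounded sequence has a unique such limit). $\mathcal{Z}_\delta=\{A\subseteq\mathbb{N}:\delta(A)=0\}$. For an ideal $\mathcal{I}$, $t(\mathcal{I})=\{A\subseteq\mathbb{N}:A+k\in\mathcal{I}\text{ for every }k\in\mathbb{Z}\}$. *)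

(* Defs.v *)
From mathcomp Require Import all_boot all_order all_algebra.
From mathcomp Require Import finmap.
From mathcomp Require Import all_classical all_reals.
From mathcomp Require Import ring lra.

Set Implicit Arguments.
Unset Strict Implicit.
Unset Printing Implicit Defensive.

Import Order.TTheory GRing.Theory Num.Theory.

Local Open Scope classical_set_scope.
Local Open Scope ring_scope.

(* The set N = {1, 2, 3, ...}; subsets of N are the A : set nat with
   A `<=` Npos, and families of subsets of N are required to consist of such
   sets. *)
Definition Npos : set nat := [set n | (0 < n)%N].

Definition shift (A : set nat) (k : int) : set nat :=
  [set m | Npos m /\ exists2 a, A a & m%:Z = a%:Z + k].

Record is_ideal (I : set (set nat)) : Prop := IsIdeal {
  ideal_subN : forall A, I A -> A `<=` Npos;
  ideal_setU : forall A B, I A -> I B -> I (A `|` B);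
  ideal_sub : forall A B, A `<=` B -> I B -> I A;
  ideal_finite : forall A, A `<=` Npos -> finite_set A -> I A;
  ideal_proper : ~ I Npos }.

Definition is_maximal_ideal (I : set (set nat)) : Prop :=
  is_ideal I /\ ~ (exists2 J, is_ideal J & I `<` J).

Definition ideal_cvg (R : realType) (J : set (set nat)) (x : nat -> R) (L : R)
    : Prop :=
  forall e : R, 0 < e -> J [set n | Npos n /\ e <= `|x n - L|].

(* The J-limit; the default value 0 if there is none. *)
Definition ideal_lim (R : realType) (J : set (set nat)) (x : nat -> R) : R :=
  xget 0 [set L | ideal_cvg J x L].

Definition freq (R : realType) (A : set nat) (n : nat) : R :=
  (#|` fset_set (A `&` [set k | (1 <= k <= n)%N])|)%:R / n%:R.

Definition delta (R : realType) (J : set (set nat)) (A : set nat) : R :=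
  ideal_lim J (@freq R A).

Definition zero_family (R : realType) (d : set nat -> R) : set (set nat) :=
  [set A | A `<=` Npos /\ d A = 0].

Definition transl (I : set (set nat)) : set (set nat) :=
  [set A | A `<=` Npos /\ forall k : int, I (shift A k)].

Section ideal_limits.
Variables (R : realType) (J : set (set nat)).
Hypothesis maxJ : is_maximal_ideal J.
Let idJ : is_ideal J := maxJ.1.

Lemma maximal_idealVC (A : set nat) : A `<=` Npos -> J A \/ J (Npos `\` A).
Proof.
move=> AN; apply: contrapT => /not_orP[nA nC]; apply: maxJ.2.
exists [set B | exists2 C, J C & B `<=` A `|` C /\ B `<=` Npos].
  split.
  - by move=> B [C _ []].
  - move=> B B' [C JC [BC BN]] [C' JC' [BC' BN']].
    exists (C `|` C'); first exact: (ideal_setU idJ).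
    split; last by move=> n [/BN|/BN'].
    by move=> n [/BC|/BC'] []; [left|right; left|left|right; right].
  - move=> B B' BB' [C JC [BC BN]]; exists C => //.
    by split=> n /BB'; [exact: BC|exact: BN].
  - move=> B BN finB; exists B; first exact: (ideal_finite idJ).
    by split => // n; right.
  - move=> [C JC [NC _]]; apply: nC; apply: (ideal_sub idJ _ JC).
    by move=> n [/NC[]].
rewrite properEneq; split; last first.
  move=> B JB; exists B => //; split; last exact: (ideal_subN idJ).
  by move=> n; right.
apply/eqP => JE; apply: nA; rewrite JE; exists set0.
  by apply: (ideal_finite idJ) => //; exact: finite_set0.
by split=> // n; left.
Qed.

Lemma ideal_cvg_unique (x : nat -> R) (L M : R) :
  ideal_cvg J x L -> ideal_cvg J x M -> L = M.
Proof.
move=> xL xM; apply: contrapT => /eqP LM.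
have e0 : 0 < `|L - M| / 2 by rewrite divr_gt0// normr_gt0 subr_eq0.
apply: (ideal_proper idJ).
apply: (ideal_sub idJ _ (ideal_setU idJ (xL _ e0) (xM _ e0))).
move=> n Nn; apply: contrapT => /not_orP[].
move=> /not_andP[//|/negP]; rewrite -ltNge => h1.
move=> /not_andP[//|/negP]; rewrite -ltNge => h2.
have := ler_distD (x n) L M; rewrite (distrC L (x n)); lra.
Qed.

Lemma ideal_cvg_bounded (x : nat -> R) (a b : R) :
  (forall n, Npos n -> a <= x n <= b) ->
  exists2 L, ideal_cvg J x L & a <= L <= b.
Proof.
move=> xab.
pose S : set R := [set c | J [set n | Npos n /\ x n < c]].
have J0 : J set0 by apply: (ideal_finite idJ) => //; exact: finite_set0.
have Sa : S a.
  apply: (ideal_sub idJ _ J0) => n [/xab/andP[h _]]; by rewrite ltNge h.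
have Sub : ubound S b.
  move=> c Sc; rewrite leNgt; apply/negP => bc; apply: (ideal_proper idJ).
  apply: (ideal_sub idJ _ Sc) => n Nn; split => //.
  by case/andP: (xab _ Nn) => _ h; exact: le_lt_trans bc.
have supS : has_sup S by split; [exists a|exists b].
exists (sup S); last first.
  by rewrite (ub_le_sup supS.2 Sa)/=; apply: ge_sup => //; exists a.
move=> e e0.
have e20 : 0 < e / 2 by rewrite divr_gt0.
have [c Sc cS] := sup_adherent e20 supS.
have : ~ S (sup S + e / 2).
  by move=> /(ub_le_sup supS.2); rewrite gerDl leNgt e20.
case: (@maximal_idealVC [set n | Npos n /\ x n < sup S + e / 2]).
  by move=> n [].
  by [].
move=> JC _; apply: (ideal_sub idJ _ (ideal_setU idJ Sc JC)) => n [Nn].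
rewrite ler_normr => /orP[h|h]; [right|left]; split => //.
  by move=> [_]; lra.
by lra.
Qed.

Lemma freqE (A : set nat) n :
  freq R A n = (count (mem A) (iota 1 n))%:R / n%:R.
Proof.
rewrite /freq -size_filter; congr (_%:R / _); apply: perm_size.
apply: uniq_perm; rewrite ?fset_uniq ?filter_uniq ?iota_uniq// => k.
have fin : finite_set (A `&` [set k | (1 <= k <= n)%N]).
  by apply: (sub_finite_set _ (finite_II n.+1)) => m [_ /andP[]].
rewrite mem_filter mem_iota add1n ltnS in_fset_set//.
by apply/idP/andP => [/set_mem[/mem_set]|[/set_mem Ak kn]] //; apply/mem_set.
Qed.

Lemma freq_bounds (A : set nat) n : 0 <= freq R A n <= 1.
Proof.
rewrite freqE divr_ge0 ?ler0n//=.
case: n => [|n]; first by rewrite invr0 mulr0.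
rewrite ler_pdivrMr ?ltr0n// mul1r ler_nat.
by rewrite (leq_trans (count_size _ _)) ?size_iota.
Qed.

Lemma delta_cvg (A : set nat) : ideal_cvg J (@freq R A) (delta R J A).
Proof.
have [|L xL _] := @ideal_cvg_bounded (@freq R A) 0 1.
  by move=> n _; exact: freq_bounds.
exact: (xgetPex 0 (ex_intro _ L xL)).
Qed.

Lemma delta_bounds (A : set nat) : 0 <= delta R J A <= 1.
Proof.
have [|L xL L01] := @ideal_cvg_bounded (@freq R A) 0 1.
  by move=> n _; exact: freq_bounds.
by rewrite (ideal_cvg_unique (@delta_cvg A) xL).
Qed.

End ideal_limits.

(* Main.v *)
Require Import Defs.
From mathcomp Require Import all_boot all_order all_algebra.
From mathcomp Require Import all_classical all_reals.
From mathcomp Require Import zify.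

Set Implicit Arguments.
Unset Strict Implicit.
Unset Printing Implicit Defensive.

Import Order.TTheory GRing.Theory Num.Theory.

Local Open Scope classical_set_scope.

(** The ultrafilter dual to [I] contains exactly one residue class [r_m] modulo
    each [m], so its translate by [-k] contains a class modulo [m] as well, and
    also that class with finitely many points removed.  Take for the translates
    by [i] and [-i] the class modulo [m = 2 ^ (i + 3)], restricted to the
    integers [>= m].  Such a truncated class has at most [n / m] elements below
    [n], so the union of all of them meets [{1, ..., n}] in at most [n / 2]
    points.  The complement of the union lies in [transl I], but it has
    frequency at least 1/2 at every [n], hence positive density along [J]. *)

(** Division by [m] is injective on one residue class and sends its points in [[m, n]] into
    [{1, ..., n %/ m}]; the bound [m <= b] excludes the quotient 0. *)
Lemma count_residue_le (P : pred nat) m n :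
  (0 < m)%N -> (forall b, P b -> (m <= b)%N) ->
  (forall a b, P a -> P b -> a = b %[mod m]) ->
  (count P (iota 1 n) <= n %/ m)%N.
Proof.
move=> m0 Pm PP; rewrite -size_filter -(size_map (fun b => b %/ m)%N).
rewrite -[leqRHS](size_iota 1); apply: uniq_leq_size.
  rewrite map_inj_in_uniq ?filter_uniq ?iota_uniq// => a b.
  rewrite !mem_filter => /andP[Pa _] /andP[Pb _] ab.
  by rewrite (divn_eq a m) (divn_eq b m) ab (PP a b).
move=> _ /mapP[b + ->]; rewrite mem_filter !mem_iota => /andP[Pb bn].
by rewrite divn_gt0// Pm//= add1n ltnS leq_div2r//; lia.
Qed.

(** The extra term [n %/ 2 ^ N] pays for the next summand: it is at least twice [n %/ 2 ^ N.+1]. *)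
Lemma sum_div_pow2 n N : (\sum_(i < N) n %/ 2 ^ i.+1 + n %/ 2 ^ N <= n)%N.
Proof.
elim: N => [|N IH]; first by rewrite big_ord0 expn0 divn1.
rewrite big_ord_recr/= expnSr divnMA -addnA; apply: leq_trans IH.
by rewrite leq_add2l; move: (n %/ 2 ^ N)%N => x; lia.
Qed.

Lemma count_exists_ord (T : Type) N (D : nat -> pred T) (s : seq T) :
  (count (fun b => [exists i : 'I_N, D i b]) s <= \sum_(i < N) count (D i) s)%N.
Proof.
elim: s => [|b s IH] /=; first by rewrite big1.
rewrite big_split/=; apply: leq_add => //.
by case: existsP => [[i Di]|//]; rewrite (bigD1 i)//= Di.
Qed.

(** Otherwise maximality puts every class modulo [m] in [I], and [Npos] is a finite union of
    them. *)
Lemma maximal_ideal_residue (I : set (set nat)) (m : nat) :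
  is_maximal_ideal I -> (0 < m)%N ->
  exists r, I (Npos `\` [set n | n = r %[mod m]]).
Proof.
move=> maxI m0; apply: contrapT => nr; have idI := maxI.1.
have Ir r : I (Npos `&` [set n | n = r %[mod m]]).
  have [|//|h] := maximal_idealVC maxI (A := Npos `&` [set n | n = r %[mod m]]).
    by move=> n [].
  case: nr; exists r; apply: ideal_sub idI _ _ _ h => n [n0 nr].
  by split=> // -[_ /nr].
have Ik k : I [set n | Npos n /\ (n %% m < k)%N].
  elim: k => [|k IH].
    apply: (ideal_finite idI) => [n []//|].
    by apply: sub_finite_set (finite_set0 _) => n [].
  apply: (ideal_sub idI _ (ideal_setU idI IH (Ir k))) => n [n0].
  rewrite ltnS leq_eqVlt => /orP[/eqP nk|nk]; last by left.
  by right; split=> //=; rewrite -nk modn_mod.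
apply: (ideal_proper idI); apply: (ideal_sub idI _ (Ik m)) => n n0.
by rewrite /= ltn_mod.
Qed.

Section SparseUnion.
Variable r : nat -> nat.

(* With [b = n - k]: the first congruence is [n = r i] for [k = i], the second
   one is [n = r i] for [k = - i]. *)
Definition truncated_classes i b : bool :=
  (2 ^ i.+3 <= b)%N &&
  ((b + i == r i %[mod 2 ^ i.+3]) || (b == r i + i %[mod 2 ^ i.+3])).

Definition sparse_compl : set nat :=
  [set b | Npos b /\ forall i, ~~ truncated_classes i b].

Lemma count_truncated_classes i n :
  (count (truncated_classes i) (iota 1 n) <= (n %/ 2 ^ i.+3).*2)%N.
Proof.
have m0 : (0 < 2 ^ i.+3)%N by rewrite expn_gt0.
pose P b := (2 ^ i.+3 <= b)%N && (b + i == r i %[mod 2 ^ i.+3]).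
pose Q b := (2 ^ i.+3 <= b)%N && (b == r i + i %[mod 2 ^ i.+3]).
rewrite (eq_count (a2 := predU P Q)); last by move=> b /=; rewrite -andb_orr.
rewrite (leq_trans (leq_addr (count (predI P Q) (iota 1 n)) _))//.
rewrite count_predUI -addnn leq_add// count_residue_le//.
- by move=> b /andP[].
- move=> a b /andP[_ /eqP aE] /andP[_ /eqP bE].
  by apply/eqP; rewrite -(eqn_modDr i) aE bE.
- by move=> b /andP[].
- by move=> a b /andP[_ /eqP ->] /andP[_ /eqP ->].
Qed.

Lemma count_sparse_compl n : (n <= (count (mem sparse_compl) (iota 1 n)).*2)%N.
Proof.
pose E b := [exists i : 'I_n, truncated_classes i b].
have cE : ((count E (iota 1 n)).*2 <= n)%N.
  apply: leq_trans (sum_div_pow2 n n).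
  apply: leq_trans (leq_addr _ _).
  rewrite -mul2n (leq_trans (leq_mul (leqnn 2) (count_exists_ord _ _ _)))//.
  rewrite big_distrr/=; apply: leq_sum => i _.
  (* The factor 4, from two classes and the doubling, is absorbed by the exponent [i.+3]. *)
  have := count_truncated_classes i n.
  rewrite [in X in X -> _](_ : 2 ^ i.+3 = 2 ^ i.+1 * 4)%N ?divnMA.
    by move: (n %/ 2 ^ i.+1)%N => x; lia.
  by rewrite -(expnD 2 i.+1 2) addn2.
suff : (n <= count (mem sparse_compl) (iota 1 n) + count E (iota 1 n))%N by lia.
rewrite -{1}(size_iota 1 n) -(count_predC E) addnC leq_add2r.
rewrite -!size_filter uniq_leq_size ?filter_uniq ?iota_uniq// => b.
rewrite !mem_filter mem_iota /= => /andP[/existsPn nE /andP[b0 bn]].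
rewrite b0 bn !andbT; apply/mem_set; split=> // i; apply/negP => Di.
(* By truncation, [2 ^ i.+3 <= b <= n]. *)
have i_n : (i < n)%N.
  case/andP: Di => + _; have := ltn_expl i.+3 (isT : 1 < 2)%N; lia.
by have /negP := nE (Ordinal i_n).
Qed.

Lemma transl_sparse_compl (I : set (set nat)) : is_ideal I ->
  (forall i, I (Npos `\` [set n | n = r i %[mod 2 ^ i.+3]])) ->
  transl I sparse_compl.
Proof.
move=> idI Ir; split=> [b []//|k]; set i := absz k.
(* Beyond this threshold [a = n - k] is at least [2 ^ i.+3], so [n] in the class of [r i] would put
   [a] in a truncated class. *)
have finI : I (Npos `&` `I_(2 ^ i.+3 + i)).
  apply: (ideal_finite idI) => [n []//|].
  exact: sub_finite_set (finite_II _).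
apply: (ideal_sub idI _ (ideal_setU idI (Ir i) finI)) => n [n0 [a [a0 aD] nE]].
have [nlt|nge] := ltnP n (2 ^ i.+3 + i); [by right|left].
split=> //= nr; have /negP := aD i; apply; apply/andP.
have [k0|k0] : n = (a + i)%N \/ a = (n + i)%N by lia.
  by split; [lia|rewrite -k0 nr eqxx].
by split; [lia|rewrite k0 eqn_modDr nr eqxx orbT].
Qed.

End SparseUnion.

Theorem theorem3p12 (R : realType) (J : set (set nat))
    (maxJ : is_maximal_ideal J) (I : set (set nat))
    (maxI : is_maximal_ideal I) :
  zero_family (delta R J) <> transl I.
Proof.
have m0 i : (0 < 2 ^ i.+3)%N by rewrite expn_gt0.
have [r Ir] := choice (fun i => maximal_ideal_residue maxI (m0 i)).
move=> ZE; have := transl_sparse_compl maxI.1 Ir; rewrite -ZE => -[_ d0].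
have half : (0 < 2^-1 :> R)%R by rewrite invr_gt0.
have := delta_cvg maxJ (sparse_compl r) half; rewrite d0 => JN.
(* Frequencies of at least 1/2 put every positive [n] in the set that [JN] places in [J]. *)
apply: (ideal_proper maxJ.1); apply: (ideal_sub maxJ.1 _ JN) => n n0.
split=> //.
rewrite subr0 ger0_norm; last by case/andP: (freq_bounds R (sparse_compl r) n).
rewrite freqE ler_pdivlMr ?ltr0n// mulrC ler_pdivrMr//.
by rewrite -natrM ler_nat muln2 count_sparse_compl.
Qed.
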